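(* Let $R$ be an integral domain of (Krull) dimension $1$. Then the following properties hold: (1) Each matrix in $Um(\mathbb{M}_2(R))$ with nonzero determinant is simply extendable. (2) Each triangular matrix in $Um(\mathbb{M}_2(R))$ is simply extendable. (3) The ring $R$ is a $\Pi_2$ domain if and only if it is an $SE_2$ (or an $E_2$) domain, and if and only if $Pic(R)$ is trivial. (4) Assume $R$ is a Dedekind domain. The ring $R$ is a $\Pi_2$ domain if and only if it is a principal ideal domain.
   Context: A matrix in $\mathbb{M}_2(R)$ is unimodular if its four entries generate the unit ideal of $R$; $Um(\mathbb{M}_2(R))$ is the set of such matrices. A matrix $A\in\mathbb{M}_2(R)$ is extendable if there exists $A^+\in SL_3(R)$ whose upper-left $2\times 2$ block is $A$; it is simply extendable if moreover $A^+$ can be chosen with $(3,3)$ entry $0$. A commutative ring $R$ is a $\Pi_2$ ring if each $A\in Um(\mathbb{M}_2(R))$ with $\det(A)=0$ is extendable; an $E_2$ ring if each matrix in $Um(\mathbb{M}_2(R))$ is extendable; an $SE_2$ ring if each matrix in $Um(\mathbb{M}_2(R))$ is simply extendable. If $R$ is moreover an integral domain, one says $\Pi_2$ domain, $E_2$ domain, $SE_2$ domain. $Pic(R)$ is the Picard group of $R$. *)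

(* Defs.v *)
From HB Require Import structures.
From mathcomp Require Import all_boot all_order all_algebra.
From mathcomp Require Import classical_sets.

Set Implicit Arguments.
Unset Strict Implicit.
Unset Printing Implicit Defensive.

Import GRing.Theory.
Local Open Scope ring_scope.
Local Open Scope classical_set_scope.

Section Matrices.
Variable R : comNzRingType.
Implicit Types A : 'M[R]_2.

Definition unimodular A : Prop :=
  exists C : 'M[R]_2, \sum_i \sum_j C i j * A i j = 1.

Definition extendable A : Prop :=
  exists Aplus : 'M[R]_(2 + 1), \det Aplus = 1 /\ ulsubmx Aplus = A.

Definition simply_extendable A : Prop :=
  exists Aplus : 'M[R]_(2 + 1),
    [/\ \det Aplus = 1, ulsubmx Aplus = A & Aplus ord_max ord_max = 0].

(* [is_trig_mx] is lower triangularity. *)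
Definition triangular A : Prop := is_trig_mx A \/ is_trig_mx A^T.

End Matrices.

Definition Pi2_ring (R : comNzRingType) : Prop :=
  forall A : 'M[R]_2, unimodular A -> \det A = 0 -> extendable A.

Definition E2_ring (R : comNzRingType) : Prop :=
  forall A : 'M[R]_2, unimodular A -> extendable A.

Definition SE2_ring (R : comNzRingType) : Prop :=
  forall A : 'M[R]_2, unimodular A -> simply_extendable A.

Section Ideals.
Variable R : comNzRingType.
Implicit Types I J : set R.

(* The library's [idealr_closed] means "proper ideal"; possibly improper ideals
   are the submodules of R as a module over itself. *)
Definition ideal I : Prop := submod_closed (mem I : {pred R^o}).

Definition is_proper_ideal I : Prop := idealr_closed (mem I).

Definition prime_ideal I : Prop :=
  is_proper_ideal I /\ prime_idealr_closed (mem I).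

Definition maximal_ideal I : Prop :=
  is_proper_ideal I /\ forall J, is_proper_ideal J -> I `<=` J -> J = I.

Definition principal_ideal I : Prop :=
  exists a, I = [set x | exists c, x = c * a].

Definition finitely_generated_ideal I : Prop :=
  exists (n : nat) (g : 'I_n -> R),
    I = [set x | exists c : 'I_n -> R, x = \sum_i c i * g i].

End Ideals.

(* P 0 < P 1 < ... < P n is a chain of length n; the values of P beyond n are
   irrelevant. *)
Definition has_prime_chain (R : comNzRingType) (n : nat) : Prop :=
  exists P : nat -> set R,
    (forall i, (i <= n)%N -> prime_ideal (P i)) /\
    (forall i, (i < n)%N -> P i `<` P i.+1).

Definition krull_dim_eq (R : comNzRingType) (d : nat) : Prop :=
  has_prime_chain R d /\ forall n, has_prime_chain R n -> (n <= d)%N.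

Definition noetherian (R : comNzRingType) : Prop :=
  forall I : set R, ideal I -> finitely_generated_ideal I.

Definition integrally_closed (R : idomainType) : Prop :=
  forall z : {fraction R},
    integralOver (@tofrac R) z -> exists a : R, z = tofrac a.

Definition dedekind_domain (R : idomainType) : Prop :=
  [/\ noetherian R, integrally_closed R &
      forall P : set R, prime_ideal P -> P <> [set 0] -> maximal_ideal P].

Definition principal_ideal_domain (R : idomainType) : Prop :=
  forall I : set R, ideal I -> principal_ideal I.

Section Picard.
Variable R : comNzRingType.

Definition module_iso (M N : lmodType R) : Prop :=
  exists f : {linear M -> N}, bijective f.

(* T, together with the bilinear map b, is a tensor product of M and N over R. *)
Definition is_tensor_product (M N T : lmodType R) (b : {bilinear M -> N -> T}) :
    Prop :=
  forall (P : lmodType R) (f : {bilinear M -> N -> P}),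
    exists g : {linear T -> P},
      (forall m n, f m n = g (b m n)) /\
      forall h : {linear T -> P}, (forall m n, f m n = h (b m n)) -> h =1 g.

(* There is an R-module N such that the tensor product of M and N is isomorphic
   to R. *)
Definition invertible_module (M : lmodType R) : Prop :=
  exists (N : lmodType R) (b : {bilinear M -> N -> R^o}),
    is_tensor_product b.

End Picard.

(* Pic(R) is the group of isomorphism classes of invertible R-modules under the
   tensor product; its identity element is the class of R. *)
Definition Pic_trivial (R : comNzRingType) : Prop :=
  forall M : lmodType R, invertible_module M -> module_iso M R^o.

(* Main.v *)
Require Import Defs.
From HB Require Import structures.
From mathcomp Require Import all_boot all_order all_algebra.
From mathcomp Require Import boolp classical_sets ring.

Set Implicit Arguments.
Unset Strict Implicit.
Unset Printing Implicit Defensive.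

Import GRing.Theory.
Local Open Scope ring_scope.

(** A 2 x 2 matrix A is simply extendable exactly when the bilinear form it
    defines takes the value 1, that is, when u A v = 1 for some row u and column
    v (simply_extendableP): this is the expansion of the determinant of a 3 x 3
    matrix with upper-left block A and lower-right entry 0.  When det A = 0 the
    lower-right entry does not contribute to that determinant, so extendable and
    simply extendable coincide (det0_extendable_simply).

    Dimension one enters through one fact (dim1_power): if d is nonzero, every x
    satisfies x ^+ n * (1 - x * y) \in (d) for some n and y.  Otherwise a prime
    containing d and avoiding all these elements would sit strictly between 0 and
    another prime.  Hence, modulo any prime containing d, one of x and 1 - x y
    vanishes, and 1 - x y serves as an indicator of the vanishing of x.  Taking
    products of such elements, two vectors v and w can be merged into v + t w
    that vanishes only at those primes above d where both v and w do
    (dim1_merge).  For A of nonzero determinant d, merging the two rows gives a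
    unimodular row (1, t) A, so A is simply extendable.  A triangular matrix of
    determinant 0 over a domain has at most one nonzero row or at most one nonzero
    column, which is then unimodular.

    For the Picard group, call a matrix of rank at most one if its 2 x 2 minors
    vanish.  Over a domain of dimension one, merging rows and then columns
    reduces a unimodular matrix B of rank at most one to a 2 x 2 one, so the Pi_2
    property yields u B v = 1 (Pi2_represents_one).  If b : M x N -> R is a
    tensor product, then sum_i b(m_i, n_i) = 1 for suitable elements, and the
    matrix of all b(m_i, n_j) is unimodular of rank at most one; a solution of
    u B v = 1 gives m and n with b(m, n) = 1, and such an m is a basis of M.
    Conversely, if B is unimodular of rank at most one with sum C_ij B_ij = 1,
    then E = B C^T is an idempotent of trace 1 and rank at most one, and its image
    is an invertible module, paired with the image of E^T by the dot product; if
    that image is free, then E = p w with w p = 1, hence w B (C^T p) = 1.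

    In a principal ideal domain b(M, z) is principal for each z, and a generator
    lifts to a basis of M, so the Picard group is trivial.  Conversely, let R be
    a Dedekind domain with the Pi_2 property, I an ideal, d a nonzero element
    of I, J = (d : I), and write the products of generators of I and of J as
    x_i y_j = d B_ij.  The matrix B has rank at most one, and a solution of
    u B v = 1 shows that sum u_i x_i generates I.  If B were not unimodular, its
    entries would lie in a prime P, which contains d, and dim1_annihilator gives a
    outside (d) with a B_ij in (d) for all i, j.  Then a / d maps the finitely
    generated nonzero ideal J into itself, so it is integral over R and lies
    in R, a contradiction. *)

(** * Simple extendability as a bilinear equation *)

(** The bilinear form attached to [B] takes the value 1. *)
Definition represents_one (R : comNzRingType) m n (B : 'M[R]_(m, n)) : Prop :=
  exists (u : 'rV_m) (v : 'cV_n), (u *m B *m v) 0 0 = 1.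

Lemma ord2P (i : 'I_2) : i = 0 \/ i = 1.
Proof. by case: i => [[|[|]]] // ?; [left|right]; apply/val_inj. Qed.

Section ExtensionsOf2x2.
Variable R : comNzRingType.

Lemma det2E (A : 'M[R]_2) : \det A = A 0 0 * A 1 1 - A 0 1 * A 1 0.
Proof.
rewrite (expand_det_row _ 0) !big_ord_recl big_ord0 /cofactor !det_mx11 !mxE /=.
have e1 : lift 0 0 = 1 :> 'I_2 by apply/val_inj.
have e0 : lift 1 0 = 0 :> 'I_2 by apply/val_inj.
by rewrite ?e1 ?e0 /= /bump /=; ring.
Qed.

Lemma det3E (A : 'M[R]_3) (i j k : 'I_3) :
  i = 0%N :> nat -> j = 1%N :> nat -> k = 2%N :> nat ->
  \det A = A i i * (A j j * A k k - A j k * A k j)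
         - A i j * (A j i * A k k - A j k * A k i)
         + A i k * (A j i * A k j - A j j * A k i).
Proof.
move=> i0 j1 k2.
rewrite (expand_det_row _ i) (bigD1 i) //= (bigD1 j) /=; last first.
  by rewrite -val_eqE /= i0 j1.
rewrite (bigD1 k) /=; last by rewrite -!val_eqE /= i0 j1 k2.
rewrite big_pred0 ?addr0; last first.
  by move=> x; rewrite -!val_eqE /= i0 j1 k2; case: x => [[|[|[|]]]].
rewrite /cofactor !det2E !mxE.
have e (x y z : 'I_3) (w : 'I_2) : bump x w = y :> nat -> lift x w = y.
  by move=> h; apply/val_inj.
rewrite !(@e i j j 0) ?(@e i k k 1) ?(@e j i i 0) ?(@e j k k 1)
   ?(@e k i i 0) ?(@e k j j 1) ?i0 ?j1 ?k2 //=; ring.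
Qed.

Lemma bilin2E (A : 'M[R]_2) (u : 'rV_2) (v : 'cV_2) :
  (u *m A *m v) 0 0 =
  u 0 0 * (A 0 0 * v 0 0 + A 0 1 * v 1 0) + u 0 1 * (A 1 0 * v 0 0 + A 1 1 * v 1 0).
Proof.
have e1 : lift 0 0 = 1 :> 'I_2 by apply/val_inj.
rewrite -mulmxA !(mxE, big_ord_recl, big_ord0) !e1; ring.
Qed.

(** The determinant of an extension of [A] is affine in the lower-right entry
    [c], and its value at [c = 0] is a value of the bilinear form of [A]. *)
Lemma det_extension (A : 'M[R]_2) (x : 'cV_2) (z : 'rV_2) (c : 'M_1) :
  \det (block_mx A x z c) =
  c 0 0 * \det A +
  ((\row_j (if j == 0 then - x 1 0 else x 0 0)) *m A *m
   (\col_j (if j == 0 then z 0 1 else - z 0 0))) 0 0.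
Proof.
rewrite (@det3E _ (@lshift 2 1 0) (@lshift 2 1 1) (@rshift 2 1 0)) // bilin2E det2E.
rewrite !(block_mxEul A x z c) !(block_mxEur A x z c) !(block_mxEdl A x z c).
by rewrite !(block_mxEdr A x z c) !mxE /=; ring.
Qed.

Lemma simply_extendableP (A : 'M[R]_2) :
  simply_extendable A <-> represents_one A.
Proof.
split=> [[B [dB uB cB]]|[u [v uv]]].
  move: dB; rewrite -[B]submxK det_extension uB => dB.
  have c0 : drsubmx B 0 0 = 0.
    by rewrite !mxE -[RHS]cB; congr (B _ _); apply/val_inj.
  by do 2 eexists; rewrite -[RHS]dB c0 mul0r add0r.
exists (block_mx A (\col_i (if i == 0 then u 0 1 else - u 0 0))
  (\row_i (if i == 0 then - v 1 0 else v 0 0)) 0).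
split; last first.
- have -> : ord_max = @rshift 2 1 0 :> 'I_(2 + 1) by apply/val_inj.
  by rewrite block_mxEdr mxE.
- by rewrite block_mxKul.
by rewrite det_extension -[RHS]uv !bilin2E !mxE /=; ring.
Qed.

Lemma det0_extendable_simply (A : 'M[R]_2) :
  \det A = 0 -> extendable A -> simply_extendable A.
Proof.
move=> dA [B [dB uB]]; apply/simply_extendableP.
move: dB; rewrite -[B]submxK det_extension uB dA mulr0 add0r => dB.
by do 2 eexists; exact: dB.
Qed.

Lemma simply_extendable_extendable (A : 'M[R]_2) :
  simply_extendable A -> extendable A.
Proof. by move=> [B [dB uB _]]; exists B. Qed.

End ExtensionsOf2x2.

(** * Existence of prime ideals *)

Local Open Scope classical_set_scope.
Section Primes.
Variable R : comNzRingType.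
Implicit Types I J P : set R.

Lemma idealP I : ideal I <->
  I 0 /\ forall a x y, I x -> I y -> I (a * x + y).
Proof.
split=> [[I0 IL]|[I0 IL]].
  split=> [|a x y Ix Iy]; first exact: set_mem.
  by apply/set_mem/IL; apply/mem_set.
split; first by apply/mem_set.
by move=> a x y /set_mem Ix /set_mem Iy; apply/mem_set/IL.
Qed.

Lemma ideal0 I : ideal I -> I 0. Proof. by case/idealP. Qed.

Lemma idealM I a x : ideal I -> I x -> I (a * x).
Proof. by move=> /idealP[I0 IL] Ix; rewrite -[_ * _]addr0; apply: IL. Qed.

Lemma idealD I x y : ideal I -> I x -> I y -> I (x + y).
Proof. by move=> /idealP[I0 IL] Ix Iy; rewrite -[x]mul1r; apply: IL. Qed.

Lemma idealB I x y : ideal I -> I x -> I y -> I (x - y).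
Proof. by move=> hI Ix Iy; rewrite addrC -mulN1r; move/idealP: hI => [_]; apply. Qed.

Lemma ideal_sum I (T : Type) (r : seq T) (F : T -> R) :
  ideal I -> (forall i, I (F i)) -> I (\sum_(i <- r) F i).
Proof.
move=> hI IF; elim/big_ind: _ => //; first exact: ideal0.
by move=> *; apply: idealD.
Qed.

Lemma proper_idealP I : is_proper_ideal I <-> ideal I /\ ~ I 1.
Proof.
split=> [[I0 I1 IL]|[hI I1]].
  split; last by move=> ?; move/negP: I1; apply; apply/mem_set.
  apply/idealP; split=> [|a x y Ix Iy]; first exact: set_mem.
  by apply/set_mem/IL; apply/mem_set.
split; first by apply/mem_set; apply: ideal0.
  by apply/negP => /set_mem.
move=> a x y /set_mem Ix /set_mem Iy; apply/mem_set.
by apply: idealD => //; apply: idealM.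
Qed.

Lemma prime_idealP P : prime_ideal P <->
  [/\ ideal P, ~ P 1 & forall x y, P (x * y) -> P x \/ P y].
Proof.
split=> [[/proper_idealP[hP P1] PM]|[hP P1 PM]].
  split=> // x y Pxy; have /orP[] := PM x y (mem_set Pxy).
    by move/set_mem; left.
  by move/set_mem; right.
split; first exact/proper_idealP.
by move=> x y /set_mem /PM[] ?; apply/orP; [left|right]; apply/mem_set.
Qed.

Lemma ideal_setDM I x : ideal I ->
  ideal [set z | exists2 y, I y & exists r, z = y + r * x].
Proof.
move=> hI; apply/idealP; split.
  by exists 0; [exact: ideal0 | exists 0; rewrite mul0r addr0].
move=> a _ _ [y Iy [r ->]] [z Iz [s ->]].
exists (a * y + z); first by apply: idealD => //; apply: idealM.
by exists (a * r + s); ring.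
Qed.

(** An ideal disjoint from a multiplicative set [S] is contained in a prime ideal
    disjoint from [S]: an ideal maximal among those disjoint from [S] is prime. *)
Lemma exists_prime I (S : set R) : ideal I -> S 1 ->
  (forall x y, S x -> S y -> S (x * y)) -> (forall x, I x -> ~ S x) ->
  exists P, [/\ prime_ideal P, I `<=` P & forall x, P x -> ~ S x].
Proof.
move=> hI S1 SM IS.
(* The empty set is included because an empty chain has empty union. *)
pose good (A : set R) := A = set0 \/
  [/\ ideal A, I `<=` A & forall x, A x -> ~ S x].
have [F Fg Ftot|A [gA Amax]] := @Zorn_bigcup R good.
  have [[B FB [b Bb]]|noB] := pselect (exists2 B, F B & B !=set0); last first.
    left; rewrite -subset0 => x [B FB Bx]; apply: noB.
    by exists B => //; exists x.
  have gB C c : F C -> C c -> [/\ ideal C, I `<=` C & forall x, C x -> ~ S x].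
    by move=> /Fg[-> //|].
  right; split.
  - apply/idealP; split.
      by exists B => //; apply: ideal0; have [] := gB B b FB Bb.
    move=> a x y [C FC Cx] [D FD Dy].
    have [hC _ _] := gB _ _ FC Cx; have [hD _ _] := gB _ _ FD Dy.
    have [CD|DC] := Ftot _ _ FC FD.
      by exists D => //; apply: idealD => //; apply: idealM => //; apply: CD.
    by exists C => //; apply: idealD (DC _ Dy) => //; apply: idealM.
  - by move=> x Ix; exists B => //; have [_ + _] := gB B b FB Bb; apply.
  - by move=> x [C FC Cx]; have [_ _] := gB C x FC Cx; apply.
have {gA}[hA IA AS] : [/\ ideal A, I `<=` A & forall x, A x -> ~ S x].
  case: gA => // A0; exfalso; apply: (Amax I); last by right; split.
  rewrite A0; split; first exact: sub0set.
  by move=> /(_ _ (ideal0 hI)).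
have meet x : ~ A x -> exists2 y, A y & exists r, S (y + r * x).
  move=> nAx; apply: contrapT => nm.
  apply: (Amax _ _ (or_intror (And3 (ideal_setDM x hA) _ _))).
  - split; first by move=> y Ay; exists y => //; exists 0; rewrite mul0r addr0.
    move=> sub; apply/nAx/sub; exists 0; first exact: ideal0.
    by exists 1; rewrite add0r mul1r.
  - by move=> y /IA Ay; exists y => //; exists 0; rewrite mul0r addr0.
  - by move=> _ [y Ay [r ->]] Sy; apply: nm; exists y => //; exists r.
exists A; split=> //; apply/prime_idealP; split=> //.
  by move=> /AS.
move=> x y Axy; apply: contrapT => /not_orP[/meet[a Aa [r Sa]] /meet[b Ab [s Sb]]].
apply: (AS _ _ (SM _ _ Sa Sb)).
have -> : (a + r * x) * (b + s * y) =
  (b + s * y) * a + ((r * x) * b + (r * s) * (x * y)) by ring.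
by do ![apply: idealD => // | apply: idealM => //].
Qed.

Lemma exists_prime_above I : ideal I -> ~ I 1 ->
  exists2 P, prime_ideal P & I `<=` P.
Proof.
move=> hI I1; have [] := @exists_prime I [set 1] hI => //.
- by move=> _ _ -> ->; rewrite /= mulr1.
- by move=> x Ix x1; apply: I1; rewrite -x1.
- by move=> P [hP IP _]; exists P.
Qed.

End Primes.

(** * Unimodular matrices and matrices of rank at most one *)

Section RankOneMatrices.
Variable R : comNzRingType.

(** The entries of [B] generate the unit ideal; for 2 x 2 matrices this is
    convertible to [unimodular]. *)
Definition unimodular_mx m n (B : 'M[R]_(m, n)) : Prop :=
  exists C : 'M[R]_(m, n), \sum_i \sum_j C i j * B i j = 1.

Lemma unimodular_mxP m n (B : 'M[R]_(m, n)) :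
  unimodular_mx B <->
  forall P : set R, prime_ideal P -> ~ forall i j, P (B i j).
Proof.
split=> [[C CB] P /prime_idealP[hP P1 _] PB|noP].
  apply: P1; rewrite -CB; do 2 (apply: ideal_sum => // ?); exact: idealM.
pose I : set R := [set x | exists C : 'M[R]_(m, n), \sum_i \sum_j C i j * B i j = x].
have hI : ideal I.
  apply/idealP; split.
    by exists 0; do 2 (apply: big1 => ? _); rewrite mxE mul0r.
  move=> a _ _ [C <-] [D <-]; exists (a *: C + D).
  rewrite mulr_sumr -big_split; apply: eq_bigr => i _ /=.
  rewrite mulr_sumr -big_split; apply: eq_bigr => j _ /=.
  by rewrite !mxE mulrDl mulrA.
apply: contrapT => I1; have [P hP IP] := exists_prime_above hI I1.
apply: (noP P hP) => i j; apply: IP; exists (delta_mx i j).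
rewrite (bigD1 i) //= (bigD1 j) //= mxE !eqxx mul1r.
rewrite big1 ?addr0 => [|j' /negPf ne]; last by rewrite mxE ne andbF mul0r.
by rewrite big1 ?addr0 // => i' /negPf ne; apply: big1 => ? _; rewrite mxE ne mul0r.
Qed.

Lemma unimodular_mx_tr m n (B : 'M[R]_(m, n)) :
  unimodular_mx B -> unimodular_mx B^T.
Proof.
move=> /unimodular_mxP uB; apply/unimodular_mxP => P hP PB.
by apply: (uB P hP) => i j; have := PB j i; rewrite mxE.
Qed.

(** All 2 x 2 minors of [B] vanish. *)
Definition rank_le1 m n (B : 'M[R]_(m, n)) : Prop :=
  forall i i' j j', B i j * B i' j' = B i j' * B i' j.

Lemma rank_le1_tr m n (B : 'M[R]_(m, n)) : rank_le1 B -> rank_le1 B^T.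
Proof. by move=> h i i' j j'; rewrite !mxE h mulrC. Qed.

Lemma rank_le1_mul m n p (U : 'M[R]_(p, m)) (B : 'M[R]_(m, n)) :
  rank_le1 B -> rank_le1 (U *m B).
Proof.
move=> h i i' j j'; rewrite !mxE !big_distrlr /=.
by do 2 (apply: eq_bigr => ? _); rewrite mulrACA h mulrACA.
Qed.

Lemma rank_le1_det (A : 'M[R]_2) : rank_le1 A <-> \det A = 0.
Proof.
rewrite det2E; split=> [h|/eqP]; first by rewrite h subrr.
rewrite subr_eq0 => /eqP h i i' j j'.
case: (ord2P i) (ord2P i') (ord2P j) (ord2P j') => -> [] -> [] -> [] -> //;
  first [by rewrite mulrC | by rewrite h | by rewrite -h
        | by rewrite mulrC h mulrC | by rewrite mulrC -h mulrC].
Qed.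

Lemma represents_one_mul m n p q
    (U : 'M[R]_(p, m)) (B : 'M[R]_(m, n)) (V : 'M[R]_(n, q)) :
  represents_one (U *m B *m V) -> represents_one B.
Proof.
by move=> [u [v uv]]; exists (u *m U), (V *m v); rewrite !mulmxA in uv *.
Qed.

Lemma represents_one_tr m n (B : 'M[R]_(m, n)) :
  represents_one B^T -> represents_one B.
Proof.
move=> [u [v uv]]; exists v^T, u^T; rewrite -uv.
by rewrite -[in RHS](trmxK (u *m _ *m v)) [in RHS]mxE !trmx_mul trmxK mulmxA.
Qed.

Lemma represents_one_row m n (B : 'M[R]_(m, n)) (u : 'rV_m) :
  unimodular_mx (u *m B) -> represents_one B.
Proof.
move=> [C CB]; exists u, C^T; rewrite mxE -CB big_ord1.
by apply: eq_bigr => j _; rewrite !mxE mulrC.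
Qed.

Lemma represents_one_single_row m n (A : 'M[R]_(m, n)) i :
  unimodular_mx A -> (forall i' j, i' != i -> A i' j = 0) -> represents_one A.
Proof.
move=> /unimodular_mxP uA A0; apply: (@represents_one_row _ _ _ (delta_mx 0 i)).
apply/unimodular_mxP => P hP PA; apply: (uA P hP) => i' j.
have [->|ne] := eqVneq i' i; first by have := PA 0 j; rewrite -rowE mxE.
by rewrite A0 //; apply: ideal0; have /prime_idealP[] := hP.
Qed.

End RankOneMatrices.

Lemma triangular_det0_represents_one (R : idomainType) (A : 'M[R]_2) :
  unimodular A -> triangular A -> \det A = 0 -> represents_one A.
Proof.
have o2 (x y : 'I_2) : x != y -> x = 1 - y.
  by case: (ord2P x) (ord2P y) => -> [] -> // _; rewrite ?subrr ?subr0.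
wlog tA : A / is_trig_mx A => [h|] uA.
  case=> tA; first by apply: h => //; left.
  rewrite -det_tr => dA; apply/represents_one_tr/h => //; last by left.
  exact: unimodular_mx_tr.
move=> _; have /is_trig_mxP A01 := tA; rewrite det2E (A01 0 1) // mul0r subr0.
move/eqP; rewrite mulf_eq0 => /orP[] /eqP A0.
  apply: (@represents_one_single_row _ _ _ _ 1) => // i j /o2 ->.
  rewrite subrr; have [->//|/o2 ->] := eqVneq j 0.
  by rewrite subr0 A01.
apply/represents_one_tr/(@represents_one_single_row _ _ _ _ 0).
  exact: unimodular_mx_tr.
move=> i j /o2 ->; rewrite subr0 mxE.
have [->//|/o2 ->] := eqVneq j 1.
by rewrite subrr A01.
Qed.

(** * Domains of dimension one *)

Section DimensionOne.
Variable R : idomainType.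
Hypothesis hdim : krull_dim_eq R 1.
Implicit Types (P : set R) (x y t d : R).

Lemma prime_ideal0 : prime_ideal ([set 0] : set R).
Proof.
apply/prime_idealP; split.
- by apply/idealP; split=> // a x y -> -> /=; rewrite mulr0 addr0.
- by move/eqP; rewrite oner_eq0.
- by move=> x y /= /eqP; rewrite mulf_eq0 => /orP[] /eqP; [left|right].
Qed.

(** In a domain of dimension at most one, the image of each [x] in R/(d) is, for
    some [n] and [y], such that x^n (1 - xy) vanishes.  If not, a prime [P]
    containing [d] and avoiding all x^n (1 - xy) does not contain [x], and
    P + (x) is proper, so [0], [P] and a prime above P + (x) form a chain of
    length 2. *)
Lemma dim1_power d x : d != 0 -> exists n y c, x ^+ n * (1 - x * y) = c * d.
Proof.
move=> d0; apply: contrapT => none.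
pose S : set R := [set s | exists n y, s = x ^+ n * (1 - x * y)].
have hI : ideal [set z : R | exists c, z = c * d].
  apply/idealP; split; first by exists 0; rewrite mul0r.
  by move=> a _ _ [b ->] [c ->]; exists (a * b + c); rewrite mulrDl mulrA.
have S1 : S 1 by exists 0%N, 0; rewrite mulr0 subr0 mulr1.
have SM s s' : S s -> S s' -> S (s * s').
  move=> [n [y ->]] [m [z ->]]; exists (n + m)%N, (y + z - x * y * z).
  by rewrite exprD; ring.
have [_ [c ->] [n [y e]]|P [hP dP PS]] := exists_prime hI S1 SM.
  by apply: none; exists n, y, c; rewrite -e.
have /prime_idealP[iP _ _] := hP.
have nPx : ~ P x.
  by move=> /PS; apply; exists 1%N, 0; rewrite mulr0 subr0 mulr1.
have [|Q hQ PQ] := exists_prime_above (ideal_setDM x iP).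
  move=> [y Py [r e]]; apply: (PS _ Py); exists 0%N, r.
  by rewrite e expr0 mul1r (mulrC x) addrK.
have P_d : P d by apply: dP; exists 1; rewrite mul1r.
have [_ /(_ 2) /=] := hdim; suff h : has_prime_chain R 2 by move/(_ h).
exists (fun i => if i is i'.+1 then if i' is 0 then P else Q else [set 0]).
split=> [[|[|i]]|[|[|i]]] //= _; first exact: prime_ideal0.
  by split=> [_ ->|/(_ _ P_d) /eqP]; [exact: ideal0 | rewrite (negPf d0)].
split=> [y Py|sub]; first by apply: PQ; exists y => //; exists 0; rewrite mul0r addr0.
apply/nPx/sub/PQ; exists 0; first exact: ideal0.
by exists 1; rewrite add0r mul1r.
Qed.

Lemma dim1_prime d x : d != 0 ->
  exists y, forall P, prime_ideal P -> P d -> P x \/ P (1 - x * y).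
Proof.
move=> d0; have [n [y [c e]]] := dim1_power x d0; exists y => P /prime_idealP[hP P1 PM] Pd.
have : P (x ^+ n * (1 - x * y)) by rewrite e; apply: idealM.
move/PM => [|]; last by right.
by elim: n {e} => [|n IH]; rewrite ?expr0 // exprS => /PM[]; [left | exact: IH].
Qed.

(** At the primes containing [d], the common zeros of the entries of v + t w are
    the common zeros of the entries of [v] and of [w]. *)
Lemma dim1_merge n (v w : 'rV[R]_n) d : d != 0 ->
  exists t, forall P, prime_ideal P -> P d ->
    (forall j, P ((v + t *: w) 0 j)) -> forall j, P (v 0 j) /\ P (w 0 j).
Proof.
move=> d0; have /choice[y hy] : forall j, exists y, forall P, prime_ideal P ->
  P d -> P (v 0 j) \/ P (1 - v 0 j * y) by move=> j; exact: dim1_prime.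
(* Modulo a prime containing d, t is 0 if some entry of v is nonzero,
   and 1 otherwise. *)
pose t := \prod_j (1 - v 0 j * y j).
exists t => P hP Pd Pvw; have /prime_idealP[iP P1 PM] := hP.
have Pv j : P (v 0 j).
  have [//|P1j] := hy j P hP Pd.
  have Pt : P t by rewrite /t (bigD1 j) //= mulrC; apply: idealM.
  have := Pvw j; rewrite !mxE => Pj.
  have -> : v 0 j = v 0 j + t * w 0 j - w 0 j * t by ring.
  by apply: idealB => //; apply: idealM.
have nPt : ~ P t.
  rewrite /t; elim/big_rec: _ => [//|j s _ nPs /PM[P1j|//]].
  apply: P1; rewrite -(subrK (v 0 j * y j) 1); apply: idealD => //.
  by rewrite mulrC; apply: idealM.
move=> j; split=> //; have := Pvw j; rewrite !mxE => Pj.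
have : P (t * w 0 j).
  by rewrite -[t * _](addKr (v 0 j)) addrC; apply: idealB.
by case/PM.
Qed.

(** The same for any number of rows: a combination of the rows of [B] that, at
    the primes containing [d], vanishes only where all of [B] does. *)
Lemma dim1_combination m n (B : 'M[R]_(m, n)) d : d != 0 ->
  exists t : 'rV_m, forall P, prime_ideal P -> P d ->
    (forall j, P ((t *m B) 0 j)) -> forall i j, P (B i j).
Proof.
move=> d0.
suff [t ht] : exists t : 'rV_m, forall P, prime_ideal P -> P d ->
    (forall j, P ((t *m B) 0 j)) -> forall i, i \in enum 'I_m -> forall j, P (B i j).
  by exists t => P hP Pd PtB i; apply: (ht P) => //; rewrite mem_enum.
elim: (enum _) => [|i s [t ht]]; first by exists 0.
have [a ha] := dim1_merge (t *m B) (row i B) d0.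
exists (t + a *: delta_mx 0 i) => P hP Pd; rewrite mulmxDl -scalemxAl -rowE.
move=> /(ha P hP Pd) h k; rewrite in_cons => /orP[/eqP-> j|ks].
  by have [_] := h j; rewrite mxE.
by apply: (ht P) => // j; have [] := h j.
Qed.

(** Two rows suffice: row [i] of [B] together with a combination of all the rows
    chosen for the primes containing the entry [B i j]. *)
Lemma dim1_reduce_rows m n (B : 'M[R]_(m, n)) i j : B i j != 0 ->
  unimodular_mx B ->
  exists2 U : 'M_(2, m), unimodular_mx (U *m B) & (U *m B) 0 j = B i j.
Proof.
move=> d0 /unimodular_mxP uB; have [t ht] := dim1_combination B d0.
pose U : 'M_(1 + 1, m) := col_mx (delta_mx 0 i) t.
have UB0 k : (U *m B) 0 k = B i k.
  have -> : 0 = lshift 1 0 :> 'I_(1 + 1) by apply/val_inj.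
  by rewrite mul_col_mx col_mxEu -rowE mxE.
exists U => //; apply/unimodular_mxP => P hP PU; apply: (uB P hP).
apply: ht => // [|k]; first by rewrite -UB0.
have : P ((U *m B) (rshift 1 0) k) by exact: PU.
by rewrite mul_col_mx col_mxEd.
Qed.

Lemma dim1_det_neq0 (A : 'M[R]_2) :
  unimodular A -> \det A != 0 -> simply_extendable A.
Proof.
move=> /unimodular_mxP uA d0; apply/simply_extendableP.
have [t ht] := dim1_merge (row 0 A) (row 1 A) d0.
apply: (@represents_one_row _ _ _ _ (delta_mx 0 0 + t *: delta_mx 0 1)).
rewrite mulmxDl -scalemxAl -!rowE; set p := row _ _ + _.
apply/unimodular_mxP => P hP Pp; have /prime_idealP[iP _ _] := hP.
(* (1, t) A adj(A) = det A (1, t), so a prime containing both entries of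
   p = (1, t) A contains det A. *)
have Pd : P (\det A).
  have -> : \det A = A 1 1 * p 0 0 - A 1 0 * p 0 1 by rewrite det2E !mxE; ring.
  by apply: idealB => //; apply: idealM.
have PA := ht P hP Pd (fun j => Pp 0 j).
apply: (uA P hP) => i j; have [] := PA j; rewrite !mxE.
by case: (ord2P i) => ->.
Qed.

Lemma Pi2_SE2 : Pi2_ring R -> SE2_ring R.
Proof.
move=> pi2 A uA; have [dA|dA] := eqVneq (\det A) 0.
  by apply: det0_extendable_simply => //; apply: pi2.
exact: dim1_det_neq0.
Qed.

Lemma Pi2_represents_one m n (B : 'M[R]_(m, n)) :
  Pi2_ring R -> unimodular_mx B -> rank_le1 B -> represents_one B.
Proof.
move=> pi2 uB rB.
have [i [j d0]] : exists i j, B i j != 0.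
  apply: contrapT => B0; have [C] := uB; rewrite big1 => [/esym/eqP|i _].
    by rewrite oner_eq0.
  apply: big1 => j _; have [->|Bij] := eqVneq (B i j) 0; first by rewrite mulr0.
  by case: B0; exists i, j.
(* B is reduced to two rows, then to two columns.  Keeping row i makes
   B i j an entry of U B, so that the same element serves both reductions. *)
have [U uUB UB0] := dim1_reduce_rows d0 uB.
have [|V uVUB _] := @dim1_reduce_rows _ _ (U *m B)^T j 0 _ (unimodular_mx_tr uUB).
  by rewrite mxE UB0.
have := unimodular_mx_tr uVUB; rewrite trmx_mul trmxK => uA.
apply: (@represents_one_mul _ _ _ _ _ U B V^T).
apply/simply_extendableP/Pi2_SE2 => //; apply/det0_extendable_simply => //.
Qed.

End DimensionOne.

(** * Invertible modules *)

(** Bundling of functions as morphisms. *)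
Lemma linear_exists (R : comNzRingType) (U V : lmodType R) (f : U -> V) :
  linear f -> exists g : {linear U -> V}, g =1 f.
Proof.
move=> lf; pose g : {linear U -> V} := HB.pack f (GRing.isLinear.Build R U V *:%R f lf).
by exists g.
Qed.

Lemma bilinear_exists (R : comNzRingType) (U V W : lmodType R) (f : U -> V -> W) :
  (forall v, linear (f^~ v)) -> (forall u, linear (f u)) ->
  exists g : {bilinear U -> V -> W}, forall u v, g u v = f u v.
Proof.
move=> lf rf.
pose g : {bilinear U -> V -> W} :=
  HB.pack f (@bilinear_isBilinear.Build R U V W
   (GRing.Scale.Law.clone _ _ *:%R _) (GRing.Scale.Law.clone _ _ *:%R _) f (lf, rf)).
by exists g.
Qed.

(** The quotient of [R] by an ideal, possibly improper, as an [R]-module. *)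
Section QuotientModule.
Variables (R : comNzRingType) (I : set R) (hI : ideal I).

(** The membership predicate of [I]; the proof that [I] is an ideal is an argument
    so that closure under subtraction can be attached to the predicate. *)
Definition ideal_pred (h : ideal I) : {pred R} := mem I.

Lemma ideal_pred_zmod_closed : zmod_closed (ideal_pred hI).
Proof.
split; first by apply/mem_set; apply: ideal0.
move=> x y /set_mem Ix /set_mem Iy; apply/mem_set; exact: idealB.
Qed.
HB.instance Definition _ :=
  GRing.isZmodClosed.Build R (ideal_pred hI) ideal_pred_zmod_closed.

Definition quotient_module := Quotient.quot (ideal_pred hI).
HB.instance Definition _ := GRing.Zmodule.on quotient_module.

Definition quotient_pi (x : R^o) : quotient_module :=
  \pi_(Quotient.quot (ideal_pred hI))%qT x.

Lemma quotient_piP x y : quotient_pi x = quotient_pi y <-> I (x - y).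
Proof.
split=> [/eqP|Ixy]; last by apply/eqP; rewrite -Quotient.idealrBE; apply/mem_set.
by rewrite -Quotient.idealrBE => /set_mem.
Qed.

Lemma quotient_piD x y : quotient_pi (x + y) = quotient_pi x + quotient_pi y.
Proof. exact: raddfD. Qed.

Lemma quotient_pi_surj q : exists x, q = quotient_pi x.
Proof. by exists (repr q); rewrite /quotient_pi reprK. Qed.

Definition quotient_scale (r : R) (q : quotient_module) : quotient_module :=
  quotient_pi (r * repr (q : Quotient.quot (ideal_pred hI))).

Lemma quotient_scaleE r x : quotient_scale r (quotient_pi x) = quotient_pi (r * x).
Proof.
apply/quotient_piP; rewrite -mulrBr; apply: idealM => //.
by apply/quotient_piP; rewrite /quotient_pi reprK.
Qed.

Fact quotient_scaleA a b v :
  quotient_scale a (quotient_scale b v) = quotient_scale (a * b) v.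
Proof.
by have [x ->] := quotient_pi_surj v; rewrite !quotient_scaleE mulrA.
Qed.
Fact quotient_scale1 : left_id 1 quotient_scale.
Proof.
by move=> v; have [x ->] := quotient_pi_surj v; rewrite quotient_scaleE mul1r.
Qed.
Fact quotient_scaleDr : right_distributive quotient_scale +%R.
Proof.
move=> a u v; have [x ->] := quotient_pi_surj u; have [y ->] := quotient_pi_surj v.
by rewrite -quotient_piD !quotient_scaleE -quotient_piD mulrDr.
Qed.
Fact quotient_scaleDl v : {morph quotient_scale^~ v : a b / a + b}.
Proof.
move=> a b; have [x ->] := quotient_pi_surj v.
by rewrite !quotient_scaleE -quotient_piD mulrDl.
Qed.
HB.instance Definition _ := GRing.Zmodule_isLmodule.Build R quotient_module
  quotient_scaleA quotient_scale1 quotient_scaleDr quotient_scaleDl.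

Lemma quotient_pi_linear : linear quotient_pi.
Proof. by move=> a x y; rewrite quotient_piD -quotient_scaleE. Qed.
HB.instance Definition _ := GRing.isLinear.Build R R^o quotient_module _
  quotient_pi quotient_pi_linear.

End QuotientModule.

Section InvertibleModule.
Variables (R : comNzRingType) (M N : lmodType R) (b : {bilinear M -> N -> R^o}).
Implicit Types (x y : M) (z w : N).

(** The ideal generated by the values of a tensor product pairing is [R]: the
    projection onto the quotient by that ideal and the zero map agree on all
    the values, hence coincide. *)
Lemma tensor_product_surj : is_tensor_product b ->
  exists s : seq (M * N), \sum_(p <- s) b p.1 p.2 = 1.
Proof.
move=> hb.
pose I : set R := [set r | exists s : seq (M * N), \sum_(p <- s) b p.1 p.2 = r].
have hI : ideal I.
  apply/idealP; split; first by exists [::]; rewrite big_nil.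
  move=> a _ _ [s <-] [t <-]; exists ([seq (a *: p.1, p.2) | p <- s] ++ t).
  rewrite big_cat big_map mulr_sumr; congr (_ + _).
  by apply: eq_bigr => p _ /=; rewrite linearZl_LR.
have [||f f0] := @bilinear_exists R M N (quotient_module hI) (fun _ _ => 0).
- by move=> ? ? ? ?; rewrite scaler0 addr0.
- by move=> ? ? ? ?; rewrite scaler0 addr0.
have [h h0] := @linear_exists R R^o (quotient_module hI) (fun _ => 0)
  (fun a _ _ => esym (etrans (addr0 _) (scaler0 _ a))).
have [g [_ guniq]] := hb _ f.
have : quotient_pi hI 1 = quotient_pi hI 0.
  rewrite (guniq (quotient_pi hI)); last first.
    move=> m n; rewrite f0 -(linear0 (quotient_pi hI)); apply/quotient_piP.
    rewrite sub0r -linearNl; exists [:: (- m, n)]; exact: big_seq1.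
  by rewrite -(guniq h) => [|m n]; rewrite ?h0 ?f0 // linear0.
by move/quotient_piP; rewrite subr0.
Qed.

Lemma tensor_product_factor (P : lmodType R) (f : {bilinear M -> N -> P}) :
  is_tensor_product b -> exists p, forall x z, f x z = b x z *: p.
Proof.
move=> hb; have [g [fg _]] := hb P f; exists (g 1) => x z.
by rewrite fg -linearZ; congr (g _); rewrite [RHS]mulr1.
Qed.

Lemma tensor_product_faithful (P : lmodType R) (p : P) :
  is_tensor_product b -> (forall x z, b x z *: p = 0) -> p = 0.
Proof.
move=> /tensor_product_surj[s s1] p0.
by rewrite -[p]scale1r -s1 scaler_suml big1.
Qed.

Lemma tensor_product_nondeg y :
  is_tensor_product b -> (forall z, b y z = 0) -> y = 0.
Proof.
move=> hb y0; apply: (tensor_product_faithful hb) => x z.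
(* As a bilinear map of (y, z), b x z *: y factors through b, so it vanishes
   when b y z does. *)
have [||f fE] := @bilinear_exists R M N M (fun y z => b x z *: y).
- by move=> z' a u v; rewrite scalerDr !scalerA mulrC.
- by move=> u a v w; rewrite linearPr scalerDl scalerA.
have [p fp] := tensor_product_factor f hb.
by rewrite -fE fp y0 scale0r.
Qed.

(** A criterion: a pairing that is symmetric in the sense of b(x, z) y = b(y, z) x,
    and likewise on the other side, and whose values generate the unit ideal, is
    a tensor product; f(x, z) = b(x, z) sum_i f(m_i, n_i) for any bilinear [f]. *)
Lemma is_tensor_productP (k : nat) (m : 'I_k -> M) (n : 'I_k -> N) :
  (forall x y z, b x z *: y = b y z *: x) ->
  (forall x z w, b x z *: w = b x w *: z) ->
  \sum_i b (m i) (n i) = 1 -> is_tensor_product b.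
Proof.
move=> swapM swapN mn1 P f.
have fE x z : f x z = b x z *: \sum_i f (m i) (n i).
  rewrite -{1}[x]scale1r -mn1 scaler_suml linear_sumlz scaler_sumr.
  apply: eq_bigr => i _.
  by rewrite swapM linearZl_LR -linearZr_LR swapN linearZr_LR.
have [g gE] : exists g : {linear R^o -> P},
    g =1 (fun r => r *: \sum_i f (m i) (n i)).
  by apply: linear_exists => a r s; rewrite scalerDl scalerA.
exists g; split=> [x z|h hE r]; first by rewrite gE.
rewrite -[r in LHS]mulr1 -mn1 mulr_sumr linear_sum gE scaler_sumr.
by apply: eq_bigr => i _; rewrite hE; exact: linearZ_LR.
Qed.

End InvertibleModule.

Section InvertibleOverDomain.
Variables (R : idomainType) (M N : lmodType R) (b : {bilinear M -> N -> R^o}).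
Hypothesis hb : is_tensor_product b.
Implicit Types (x y : M) (z w : N).

(** The bilinear map (x, z) |-> b(x, z1) b(x1, z) factors through [b]; evaluating
    at (x1, z1) identifies the factor as b(x1, z1) when that value is nonzero.
    The remaining case follows by applying this to other pairs. *)
Lemma tensor_product_rank_le1 x y z w : b x z * b y w = b x w * b y z.
Proof.
have cross x1 z1 : b x1 z1 != 0 ->
    forall x z, b x z1 * b x1 z = b x z * b x1 z1.
  move=> nz; have [||f fE] := @bilinear_exists R M N R^o
      (fun x z => b x z1 * b x1 z).
  - by move=> v a u u'; rewrite linearPl mulrDl -mulrA.
  - by move=> u a v v'; rewrite linearPr mulrDr [LHS]/= mulrCA.
  have [p fp] := tensor_product_factor f hb.
  have {}fp x' z' : b x' z1 * b x1 z' = b x' z' * p by rewrite -fE fp.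
  by have /(mulfI nz) {1}-> := fp x1 z1.
have [yz0|nz] := eqVneq (b y z) 0; last by rewrite cross.
have [xz0|nz] := eqVneq (b x z) 0; first by rewrite yz0 xz0 mul0r mulr0.
by rewrite mulrC -(cross _ _ nz) yz0 mul0r mulr0.
Qed.

Lemma tensor_product_swap x y z : b x z *: y = b y z *: x.
Proof.
apply/eqP; rewrite -subr_eq0; apply/eqP/(tensor_product_nondeg hb) => w.
rewrite linearBl !linearZl_LR; apply/eqP; rewrite subr_eq0; apply/eqP.
exact: (etrans (tensor_product_rank_le1 x y z w) (mulrC _ _)).
Qed.

Lemma tensor_product_free x z : b x z = 1 -> module_iso M R^o.
Proof.
move=> xz1.
have [f fE] : exists f : {linear M -> R^o}, f =1 b^~ z.
  by apply: linear_exists => a u v; rewrite linearPl.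
exists f; exists (fun r => r *: x) => [y|r]; rewrite fE.
  by rewrite tensor_product_swap xz1 scale1r.
by rewrite linearZl_LR xz1 [LHS]mulr1.
Qed.

(** Choose [z0] with b(-, z0) nonzero, hence injective.  An [x] such that b(x, z0)
    generates its image generates [M]. *)
Lemma tensor_product_principal :
  principal_ideal_domain R -> module_iso M R^o.
Proof.
move=> pid; have [s s1] := tensor_product_surj hb.
have [x0 [z0 nz]] : exists x z, b x z != 0.
  apply: contrapT => b0; have : \sum_(p <- s) b p.1 p.2 = 0.
    apply: big1 => p _; apply/eqP/negPn/negP => nz.
    by apply: b0; exists p.1, p.2.
  by rewrite s1 => /eqP; rewrite oner_eq0.
have inj x : b x z0 = 0 -> x = 0.
  move=> xz; apply: (tensor_product_nondeg hb) => w.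
  have := tensor_product_rank_le1 x x0 z0 w; rewrite xz mul0r.
  by move/esym/eqP; rewrite mulf_eq0 (negPf nz) orbF => /eqP.
have [|a aE] := pid [set r | exists x, r = b x z0].
  apply/idealP; split; first by exists 0; rewrite linear0l.
  by move=> a _ _ [x ->] [y ->]; exists (a *: x + y); rewrite linearPl.
have [x ax] : [set r | exists x, r = b x z0] a.
  by rewrite aE; exists 1; rewrite mul1r.
have /choice[c cx] : forall y, exists c, y = c *: x.
  move=> y; have : [set r | exists x, r = b x z0] (b y z0) by exists y.
  rewrite aE => -[c e]; exists c; apply/eqP; rewrite -subr_eq0; apply/eqP/inj.
  by rewrite linearBl linearZl_LR e ax subrr.
apply: (@tensor_product_free x (\sum_(p <- s) c p.1 *: p.2)).
rewrite linear_sumr -s1. apply: eq_bigr => p _.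
by rewrite [in RHS](cx p.1) linearZl_LR linearZr_LR.
Qed.

Lemma tensor_product_Pi2 :
  krull_dim_eq R 1 -> Pi2_ring R -> module_iso M R^o.
Proof.
move=> hdim pi2; have [s s1] := tensor_product_surj hb.
pose t := in_tuple s.
pose B : 'M[R]_(size s) := \matrix_(i, j) b (tnth t i).1 (tnth t j).2.
have uB : unimodular_mx B.
  exists 1%:M; rewrite -[RHS]s1 [RHS]big_tnth; apply: eq_bigr => i _.
  rewrite (bigD1 i) //= !mxE eqxx mul1r big1 ?addr0 // => j /negPf ne.
  by rewrite !mxE eq_sym ne mul0r.
have [|u [v uv]] := Pi2_represents_one hdim pi2 uB.
  by move=> i i' j j'; rewrite !mxE tensor_product_rank_le1.
apply: (@tensor_product_free (\sum_i u 0 i *: (tnth t i).1)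
  (\sum_j v j 0 *: (tnth t j).2)).
rewrite linear_sumr -uv mxE; apply: eq_bigr => j _.
rewrite linearZr_LR linear_sumlz mxE mulr_suml scaler_sumr.
apply: eq_bigr => i _; rewrite linearZl_LR !mxE; exact: mulrC.
Qed.

End InvertibleOverDomain.

Lemma Pi2_Pic_trivial (R : idomainType) :
  krull_dim_eq R 1 -> Pi2_ring R -> Pic_trivial R.
Proof. by move=> hdim pi2 M [N [b hb]]; exact: tensor_product_Pi2 hb hdim pi2. Qed.

Lemma PID_Pic_trivial (R : idomainType) :
  principal_ideal_domain R -> Pic_trivial R.
Proof. by move=> pid M [N [b hb]]; exact: tensor_product_principal hb pid. Qed.

(** * From trivial Picard group to matrices of rank at most one *)

(** The module of row vectors fixed by [E], which is the row space of [E] when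
    [E] is idempotent. *)
Section FixedModule.
Variables (R : comNzRingType) (n : nat) (E : 'M[R]_n).

Definition fixed_rows : {pred 'rV[R]_n} := fun x => x *m E == x.

Lemma fixed_rows_submod_closed : submod_closed fixed_rows.
Proof.
split; first by apply/eqP; rewrite mul0mx.
move=> a x y /eqP xE /eqP yE; apply/eqP.
by rewrite mulmxDl -scalemxAl xE yE.
Qed.
HB.instance Definition _ :=
  GRing.isSubmodClosed.Build R 'rV[R]_n fixed_rows fixed_rows_submod_closed.

Record fixed_module :=
  FixedModule { fixed_val :> 'rV[R]_n; _ : fixed_val \in fixed_rows }.

HB.instance Definition _ := [isSub for @fixed_val].
HB.instance Definition _ := [Choice of fixed_module by <:].
HB.instance Definition _ := [SubChoice_isSubLmodule of fixed_module by <:].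

Lemma fixed_valP (x : fixed_module) : x *m E = x.
Proof. by apply/eqP; case: x. Qed.

Lemma fixed_valZD a (x y : fixed_module) :
  fixed_val (a *: x + y) = a *: fixed_val x + fixed_val y.
Proof. exact: (linearP (val : fixed_module -> _)). Qed.

Lemma fixed_swap (x y : fixed_module) i j :
  rank_le1 E -> x 0 i * y 0 j = y 0 i * x 0 j.
Proof.
move=> rE; rewrite -[in LHS](fixed_valP x) -[in LHS](fixed_valP y).
rewrite -[in RHS](fixed_valP x) -[in RHS](fixed_valP y) !mxE !big_distrlr /=.
rewrite [RHS]exchange_big /=; do 2 (apply: eq_bigr => ? _).
by rewrite mulrACA rE; ring.
Qed.

Lemma rank_le1_idempotent : rank_le1 E -> \tr E = 1 -> E *m E = E.
Proof.
move=> rE tE; apply/matrixP => i j; rewrite mxE -[RHS]mulr1 -tE mulr_sumr.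
by apply: eq_bigr => k _; rewrite rE.
Qed.

End FixedModule.

Section FixedPairing.
Variables (R : comNzRingType) (n : nat) (E : 'M[R]_n).
Hypotheses (rE : rank_le1 E) (tE : \tr E = 1).
Local Notation M := (fixed_module E).
Local Notation N := (fixed_module E^T).

(** The inverse is the module of rows fixed by the transpose of [E], paired by the
    dot product. *)
Lemma fixed_invertible : invertible_module M.
Proof.
have [||b bE] := @bilinear_exists R M N R^o
    (fun x y => \sum_i (x : 'rV_n) 0 i * (y : 'rV_n) 0 i).
- move=> y a u v; rewrite scaler_sumr -big_split; apply: eq_bigr => i _.
  by rewrite fixed_valZD !mxE mulrDl -mulrA.
- move=> x a u v; rewrite scaler_sumr -big_split; apply: eq_bigr => i _.
  by rewrite fixed_valZD !mxE mulrDr mulrCA.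
have EE := rank_le1_idempotent rE tE.
have mP i : row i E \in fixed_rows E by apply/eqP; rewrite -row_mul EE.
have nP i : row i E^T \in fixed_rows E^T.
  by apply/eqP; rewrite -row_mul -trmx_mul EE.
exists N, b.
apply: (@is_tensor_productP _ _ _ b n (fun i => FixedModule (mP i))
  (fun i => FixedModule (nP i))).
- move=> x y z; apply/val_inj/rowP => j; rewrite !linearZ !mxE !bE !mulr_suml.
  apply: eq_bigr => i _; rewrite mulrAC (fixed_swap x y i j rE); exact: mulrAC.
- move=> x z w; apply/val_inj/rowP => j; rewrite !linearZ !mxE !bE !mulr_suml.
  apply: eq_bigr => i _; rewrite -!mulrA; congr (_ * _).
  exact/fixed_swap/rank_le1_tr.
rewrite -tE; apply: eq_bigr => i _; rewrite bE -[in RHS]EE mxE.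
by apply: eq_bigr => j _; rewrite !mxE.
Qed.

Lemma Pic_trivial_idempotent : Pic_trivial R -> represents_one E.
Proof.
move=> /(_ _ fixed_invertible)[f [g fK gK]].
have EE := rank_le1_idempotent rE tE.
have mP i : row i E \in fixed_rows E by apply/eqP; rewrite -row_mul EE.
(* w is a basis of the module of fixed rows, and p lists the coordinates
   of the rows of E. *)
pose w : 'rV_n := val (g 1).
have wE (x : M) : val x = f x *: w.
  rewrite -[x in LHS]fK -linearZ; congr (val _); apply: (can_inj fK).
  by rewrite linearZ !gK [RHS]mulr1.
pose p : 'cV_n := \col_i f (FixedModule (mP i)).
have Epw : E = p *m w.
  apply/row_matrixP => i; rewrite row_mul.
  have -> : row i p = (f (FixedModule (mP i)))%:M.
    by apply/rowP => j; rewrite !mxE ord1 mulr1n.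
  by rewrite mul_scalar_mx -wE.
have wp : w *m p = 1%:M.
  rewrite [LHS]mx11_scalar; congr (_%:M).
  by rewrite -tE Epw mxtrace_mulC /mxtrace big_ord1.
by exists w, p; rewrite [in w *m E]Epw !mulmxA wp mul1mx wp mxE.
Qed.

End FixedPairing.

Lemma Pic_trivial_represents_one (R : comNzRingType) m n (B : 'M[R]_(m, n)) :
  Pic_trivial R -> unimodular_mx B -> rank_le1 B -> represents_one B.
Proof.
move=> pic [C CB] rB; apply: (@represents_one_mul _ _ _ _ _ 1%:M B C^T).
apply: Pic_trivial_idempotent => //.
  rewrite mul1mx -[B *m _]trmxK trmx_mul; apply/rank_le1_tr/rank_le1_mul.
  exact: rank_le1_tr.
rewrite mul1mx -CB; apply: eq_bigr => i _; rewrite mxE.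
by apply: eq_bigr => j _; rewrite mxE mulrC.
Qed.

Lemma Pic_trivial_Pi2 (R : comNzRingType) : Pic_trivial R -> Pi2_ring R.
Proof.
move=> pic A uA dA; apply/simply_extendable_extendable/simply_extendableP.
by apply: Pic_trivial_represents_one => //; apply/rank_le1_det.
Qed.

(** * Dedekind domains *)

Section Dedekind.
Variable R : idomainType.

Lemma mulmx_col_row k l (a : 'M[R]_(k, 1)) (b : 'M[R]_(1, l)) i j :
  (a *m b) i j = a i 0 * b 0 j.
Proof. by rewrite mxE big_ord1. Qed.

(** Finite generation, with the generators collected in a column. *)
Lemma fg_idealP (I : set R) : finitely_generated_ideal I ->
  exists k (X : 'cV[R]_k), forall z, I z <-> exists e : 'rV_k, z = (e *m X) 0 0.
Proof.
move=> [k [g ->]]; exists k, (\col_i g i) => z; split=> -[e ->].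
  by exists (\row_i e i); rewrite mxE; apply: eq_bigr => i _; rewrite !mxE.
by exists (fun i => e 0 i); rewrite mxE; apply: eq_bigr => i _; rewrite !mxE.
Qed.

(** If a / d is an eigenvalue of a matrix with entries in [R], then it is a root of
    the characteristic polynomial, so it lies in [R] when [R] is integrally
    closed. *)
Lemma integrally_closed_eigen n (M : 'M[R]_n) (y : 'rV_n) a d :
  integrally_closed R -> d != 0 -> y != 0 -> a *: y = d *: (y *m M) ->
  exists c, a = c * d.
Proof.
move=> icR d0 y0 ay; pose F := {fraction R}.
have fd0 : tofrac d != 0 :> F by rewrite tofrac_eq0.
have [|c ec] := icR (tofrac a / tofrac d); last first.
  exists c; apply/eqP; rewrite -tofrac_eq.
  by rewrite tofracM -ec divfK.
exists (char_poly M); first exact: char_poly_monic.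
rewrite map_char_poly -eigenvalue_root_char.
apply/eigenvalueP; exists (map_mx (@tofrac R) y).
  by apply: (scalerI fd0); rewrite scalerA mulrC divfK // -map_mxM -!map_mxZ ay.
apply: contra_neq y0 => /matrixP y0.
apply/matrixP => i j; have := y0 i j; rewrite !mxE => /eqP.
by rewrite tofrac_eq0 => /eqP.
Qed.

Hypothesis hdim : krull_dim_eq R 1.

(** Elements x_i of a prime containing [d] have a common nonzero annihilator in
    R/(d): start from the product of the 1 - x_i y_i provided by [dim1_power],
    which lies outside [P] and becomes a multiple of [d] after multiplication by a
    power of each x_i; then multiply by each x_i as often as possible while staying
    outside (d). *)
Lemma dim1_annihilator (T : finType) (x : T -> R) d (P : set R) :
  d != 0 -> prime_ideal P -> P d -> (forall i, P (x i)) ->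
  exists2 a, ~ (exists c, a = c * d) & forall i, exists c, a * x i = c * d.
Proof.
move=> d0 hP Pd Px; have /prime_idealP[iP P1 PM] := hP.
pose D a := exists c, a = c * d.
have DM a r : D a -> D (a * r) by move=> [c ->]; exists (c * r); rewrite mulrAC.
have /choice[q hq] : forall i, exists q : nat * R, D (x i ^+ q.1 * (1 - x i * q.2)).
  by move=> i; have [n [y h]] := dim1_power hdim (x i) d0; exists (n, y).
pose s := \prod_i (1 - x i * (q i).2).
have nDs : ~ D s.
  suff nPs : ~ P s by move=> [c sc]; apply: nPs; rewrite sc; apply: idealM.
  rewrite /s; elim/big_rec: _ => // i r _ nPr /PM[|//] h.
  apply: P1; rewrite -(subrK (x i * (q i).2) 1); apply: idealD => //.
  by rewrite mulrC; apply: idealM.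
have step y : forall n a, ~ D a -> D (a * y ^+ n) ->
    exists2 j, ~ D (a * y ^+ j) & D (a * y ^+ j.+1).
  elim=> [|n IH] a na; first by rewrite mulr1.
  by have [/(IH a na)|] := pselect (D (a * y ^+ n)); [|exists n].
suff [a na [_ ha]] : exists2 a, ~ D a & (exists r, a = s * r) /\
    forall i, i \in enum T -> D (a * x i).
  by exists a => // i; apply: ha; rewrite mem_enum.
elim: (enum T) => [|i l [a na [[r ar] ha]]].
  by exists s => //; split=> //; exists 1; rewrite mulr1.
have [|j nj hj] := step (x i) (q i).1 a na.
  rewrite ar /s (bigD1 i) //=; set w := \prod_(_ | _) _.
  by have := DM _ (w * r) (hq i); congr D; ring.
exists (a * x i ^+ j) => //; split; first by exists (r * x i ^+ j); rewrite ar mulrA.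
move=> k; rewrite in_cons => /orP[/eqP->|/ha h]; first by rewrite -mulrA -exprSr.
by rewrite mulrAC; apply: DM.
Qed.

(** A nonzero ideal [I] is generated by sum u_i x_i, where u B v = 1 and [B] is
    the matrix of the products of generators of [I] and of J = (d : I),
    divided by [d]. *)
Lemma dedekind_Pi2_PID :
  noetherian R -> integrally_closed R -> Pi2_ring R -> principal_ideal_domain R.
Proof.
move=> noeR icR pi2 I hI.
have [[d Id d0]|I0] := pselect (exists2 d, I d & d != 0); last first.
  exists 0; apply/seteqP; split=> [x Ix|_ [c ->]]; last first.
    by rewrite mulr0; apply: ideal0.
  exists 0; rewrite mulr0; apply/eqP/negPn/negP => x0; apply: I0; by exists x.
pose J : set R := [set y | forall x, I x -> exists h, x * y = h * d].
have hJ : ideal J.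
  apply/idealP; split=> [x _|a y z Jy Jz x Ix]; first by exists 0; rewrite mulr0 mul0r.
  have [h e] := Jy x Ix; have [h' e'] := Jz x Ix; exists (a * h + h').
  by rewrite mulrDr e' mulrCA e; ring.
have [k [X IX]] := fg_idealP (noeR _ hI).
have [l [Y JY]] : exists l (Y : 'rV[R]_l), forall z,
    J z <-> exists v : 'cV_l, z = (Y *m v) 0 0.
  have [l [Z JZ]] := fg_idealP (noeR _ hJ).
  exists l, Z^T => z; rewrite JZ; split=> -[e ->]; exists e^T.
    by rewrite -trmx_mul [RHS]mxE.
  by rewrite -[Z^T *m e]trmxK trmx_mul trmxK [LHS]mxE.
have IXi i : I (X i 0) by apply/IX; exists (delta_mx 0 i); rewrite -rowE [RHS]mxE.
have JYj j : J (Y 0 j) by apply/JY; exists (delta_mx j 0); rewrite -colE [RHS]mxE.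
have /choice[h hE] : forall ij : 'I_k * 'I_l, exists h, X ij.1 0 * Y 0 ij.2 = h * d.
  by move=> [i j]; apply: JYj.
pose B : 'M[R]_(k, l) := \matrix_(i, j) h (i, j).
have XYB : X *m Y = d *: B.
  by apply/matrixP => i j; rewrite mulmx_col_row !mxE (hE (i, j)) mulrC.
have pair (e : 'rV_k) (v : 'cV_l) :
    (e *m X) 0 0 * (Y *m v) 0 0 = (e *m B *m v) 0 0 * d.
  by rewrite -mulmx_col_row -mulmxA (mulmxA X) XYB -scalemxAl -scalemxAr mxE mulmxA mulrC.
have rB : rank_le1 B.
  move=> i i' j j'; apply: (mulIf (mulf_neq0 d0 d0)); rewrite mulrACA [RHS]mulrACA !mxE.
  by rewrite -!hE /=; ring.
have [e0 de0] : exists e, d = (e *m X) 0 0 := (IX d).1 Id.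
have Jd : J d by move=> x _; exists x.
have [v0 dv0] : exists v, d = (Y *m v) 0 0 := (JY d).1 Jd.
have uB : unimodular_mx B.
  apply/unimodular_mxP => P hP PB; have /prime_idealP[iP _ _] := hP.
  have Pd : P d.
    have -> : d = (e0 *m B *m v0) 0 0 by apply: (mulIf d0); rewrite -pair -de0 -dv0.
    rewrite mxE; apply: ideal_sum => // j; rewrite mulrC; apply: idealM => //.
    by rewrite mxE; apply: ideal_sum => // i; apply: idealM.
  have [|a na /choice[c aB]] := @dim1_annihilator _ h d P d0 hP Pd.
    by move=> [i j]; have := PB i j; rewrite mxE.
  pose C : 'M[R]_(k, l) := \matrix_(i, j) c (i, j).
  have aBC : a *: B = d *: C by apply/matrixP => i j; rewrite !mxE aB mulrC.
  (* multiplication by a / d maps J into itself: the row of generators Y of J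
     satisfies (a / d) Y = W with entries of W in J *)
  have aY (e : 'rV_k) : (e *m X) 0 0 *: (a *: Y) = (d * d) *: (e *m C).
    rewrite -mul_scalar_mx -mx11_scalar -scalemxAr -mulmxA XYB -scalemxAr.
    by rewrite scalerA [a * d]mulrC -!scalerA [in LHS]scalemxAr aBC -scalemxAr.
  pose W := e0 *m C.
  have aYW : a *: Y = d *: W.
    apply/rowP => j; apply: (mulfI d0).
    have := congr1 (fun M : 'rV_l => M 0 j) (aY e0).
    by rewrite -de0 !mxE -mulrA.
  have JW j : J (W 0 j).
    move=> x /IX[e ->]; exists ((e *m C) 0 j); apply: (mulIf d0).
    have eWC : (e *m X) 0 0 * (d * W 0 j) = d * d * (e *m C) 0 j.
      have scE r (M : 'rV_l) : (r *: M) 0 j = r * M 0 j by rewrite mxE.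
      by have := congr1 (fun M : 'rV_l => M 0 j) (aY e); rewrite aYW !scE.
    by rewrite -mulrA [W 0 j * d]mulrC eWC; ring.
  have /choice[m mW] : forall j, exists e : 'cV_l, W 0 j = (Y *m e) 0 0.
    by move=> j; exact: (JY _).1 (JW j).
  apply/na/(@integrally_closed_eigen _ (\matrix_(i, j) m j i 0) Y a d icR d0).
    by apply: contra_neq d0 => Y0; rewrite dv0 Y0 mul0mx mxE.
  rewrite aYW; congr (_ *: _); apply/rowP => j; rewrite mW !mxE.
  by apply: eq_bigr => i _; rewrite !mxE.
have [u [v uv]] := Pi2_represents_one hdim pi2 uB rB.
have abd := pair u v; rewrite uv mul1r in abd.
exists ((u *m X) 0 0); apply/seteqP; split=> [z /IX[e ->]|_ [c ->]]; last first.
  by apply: idealM => //; apply/IX; exists u.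
exists ((e *m B *m v) 0 0).
have b0 : (Y *m v) 0 0 != 0.
  by apply: contra_neq d0 => b0; rewrite -abd b0 mulr0.
by apply: (mulIf b0); rewrite pair -mulrA abd.
Qed.

End Dedekind.

Local Close Scope classical_set_scope.

Theorem theorem1p7 (R : idomainType) (hdim : krull_dim_eq R 1) :
  (forall A : 'M[R]_2, unimodular A -> \det A <> 0 -> simply_extendable A) /\
  (forall A : 'M[R]_2, unimodular A -> triangular A -> simply_extendable A) /\
  ((Pi2_ring R <-> SE2_ring R) /\
   (Pi2_ring R <-> E2_ring R) /\
   (Pi2_ring R <-> Pic_trivial R)) /\
  (dedekind_domain R -> (Pi2_ring R <-> principal_ideal_domain R)).
Proof.
have det_nz (A : 'M[R]_2) : unimodular A -> \det A <> 0 -> simply_extendable A.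
  by move=> uA /eqP; apply: dim1_det_neq0.
split; first exact: det_nz.
split.
  move=> A uA tA; have [dA|/eqP dA] := eqVneq (\det A) 0; last exact: det_nz.
  exact/simply_extendableP/triangular_det0_represents_one.
have Pi2_SE := Pi2_SE2 hdim.
have SE_E : SE2_ring R -> E2_ring R.
  by move=> se A /se; apply: simply_extendable_extendable.
have E_Pi2 : E2_ring R -> Pi2_ring R by move=> e A uA _; apply: e.
split.
  split; first by split=> [|/SE_E].
  split; first by split=> [/Pi2_SE|].
  by split=> [|]; [exact: Pi2_Pic_trivial | exact: Pic_trivial_Pi2].
move=> [noeR icR _]; split; first exact: dedekind_Pi2_PID.
by move=> /PID_Pic_trivial; apply: Pic_trivial_Pi2.
Qed.
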